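(* Let $\mathrm{Fl} = \{\mathrm{fl}_0,\dots,\mathrm{fl}_n\}$ be a tuple of functions which round to nearest in a perfect floating point system with unit roundoff $u$. If $20 n u\leq 1$ and $\mathbf{x},\mathbf{y}\in\mathbb{R}^{n+1}$, then $$\left| \mathrm{fma}_{\mathrm{Fl}}\left(\sum_{k=0}^n x_k y_k\right) - \sum_{k=0}^n x_k y_k\right| \leq \frac{(n+1)u}{1+(n+1)u}\sum_{k=0}^n |x_k y_k|.$$
   Context: Let $\beta \ge 2$ be an integer (the base) and $\mu \ge 1$ an integer. The unit roundoff is $u := 1/(2\beta^{\mu})$. For $e\in\mathbb{Z}$ let $\mathcal{E}_e := \{\beta^e(\beta^\mu + r) : r = 0,1,\dots,(\beta-1)\beta^\mu - 1\}$. The perfect floating point system associated to $\beta,\mu$ is $\mathcal{P} := \{0\} \cup \bigcup_{e\in\mathbb{Z}} (\mathcal{E}_e \cup -\mathcal{E}_e)$. A function $\mathrm{fl}:\mathbb{R}\to\mathbb{R}$ rounds to nearest in a system $\mathcal{F}$ if for all $z\in\mathbb{R}$ one has $\mathrm{fl}(z)\in\mathcal{F}$ and $|\mathrm{fl}(z)-z|\le|x-z|$ for all $x\in\mathcal{F}$ (ties may be broken arbitrarily). A tuple rounds to nearest in $\mathcal{F}$ if each of its elements does (the elements may differ). Dot product with fused multiply-add: put $\hat s_0 := \mathrm{fl}_0(x_0y_0)$ and $\hat s_k := \mathrm{fl}_k(\hat s_{k-1}+x_ky_k)$ for $1\le k\le n$. Then $\mathrm{fma}_{\mathrm{Fl}}\left(\sum_{k=0}^n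 x_ky_k\right) := \hat s_n$. *)

(* Defs.v *)
From mathcomp Require Import all_boot all_order all_algebra.
From mathcomp Require Import classical_sets reals.

Set Implicit Arguments.
Unset Strict Implicit.
Unset Printing Implicit Defensive.

Import Order.TTheory GRing.Theory Num.Theory.

Local Open Scope classical_set_scope.
Local Open Scope ring_scope.

Definition unit_roundoff (R : realType) (beta mu : nat) : R :=
  1 / (2 * beta%:R ^+ mu).
Arguments unit_roundoff : clear implicits.

(* The exponent e ranges over all of int, so [beta%:R ^ e] is the
   integer-exponent power [exprz]. *)
Definition binade (R : realType) (beta mu : nat) (e : int) : set R :=
  [set x | exists r : nat, (r < (beta - 1) * beta ^ mu)%N /\
                           x = beta%:R ^ e * (beta ^ mu + r)%:R].
Arguments binade : clear implicits.

Definition perfect_system (R : realType) (beta mu : nat) : set R :=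
  [set 0] `|` \bigcup_(e in [set: int])
                (binade R beta mu e `|` [set - x | x in binade R beta mu e]).
Arguments perfect_system : clear implicits.

(* Ties are unconstrained: any function picking a nearest element qualifies. *)
Definition rounds_to_nearest (R : realType) (F : set R) (fl : R -> R) : Prop :=
  forall z : R, F (fl z) /\ forall x : R, F x -> `|fl z - z| <= `|x - z|.

(* Meaningful for k <= n only, where [inord k : 'I_n.+1] has value k. *)
Fixpoint fma_partial (R : realType) (n : nat) (fl : 'I_n.+1 -> R -> R)
    (x y : 'rV[R]_n.+1) (k : nat) : R :=
  let i : 'I_n.+1 := inord k in
  if k is k'.+1
  then fl i (fma_partial fl x y k' + x ord0 i * y ord0 i)
  else fl i (x ord0 i * y ord0 i).

Definition fma_dot (R : realType) (n : nat) (fl : 'I_n.+1 -> R -> R)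
    (x y : 'rV[R]_n.+1) : R :=
  fma_partial fl x y n.

(* Main.v *)
Require Import Defs.
From mathcomp Require Import all_boot all_order all_algebra.
From mathcomp Require Import classical_sets reals.
From mathcomp Require Import zify ring lra.

(** The dot product is a recursive summation with [N = n + 1] roundings,
    started from 0: [s_0 = 0] and [s_(k+1) = fl_k (s_k + p_k)] with
    [p_k = x_k y_k].  Let [d_k] be the [k]-th rounding error, [S] the sum of the
    [|p_k|], [E] the sum of the [|d_k|], and [D = S - E].  The total error is at
    most [E], and [E <= N u / (1 + N u) * S] is the same as [E <= N u D].

    Let [B_k] be the largest power of the base not above [|s_k + p_k|] (or 0 if that
    sum is 0).  Two facts about a single rounding are used
    ([nearest_error_power]): [|d_k| <= u B_k], as the spacing near [s_k + p_k] is
    [2 u B_k], and [|d_k| <= |s_k + p_k| - B_k], as [B_k] is in the system.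
    Moreover [|d_k| <= |p_k|], as [s_k] is in the system; hence [D] never
    decreases as the summation proceeds.

    Let [B] be the largest of the [B_k], first reached at step [K].  The [K]
    earlier errors are at most [u B / 2] each, since a smaller power of the base
    is at most [B / 2], and the others are at most [u B]; so
    [E <= u B (N - K / 2)].  At step [K] the exact sum has modulus at least [B],
    while it is at most [S + E] for the partial values of [S] and [E]; from this
    [D >= B - 2 (K u B / 2) = B (1 - K u)] there, hence at the end.  When
    [2 N u <= 1] these two bounds give [E <= N u D].  The induction
    ([recsum_invariant]) carries the combination of the two bounds from which
    [K] has been eliminated, together with [E <= N u B].

    The hypothesis [20 n u <= 1] gives [2 (n + 1) u <= 1] for [n > 0], and for
    [n = 0] this is [u <= 1 / 4]. *)

Import Order.TTheory GRing.Theory Num.Theory.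
Local Open Scope ring_scope.

(** * Powers of the base and the perfect system *)

Definition zero_or_power {R : realType} (beta : nat) (B : R) : Prop :=
  B = 0 \/ exists m : int, B = beta%:R ^ m.

Section PerfectSystem.
Variables (R : realType) (beta mu : nat).
Hypothesis hbeta : (2 <= beta)%N.

Local Notation b := (beta%:R : R).
Local Notation u := (unit_roundoff R beta mu).
Local Notation F := (perfect_system R beta mu).

Lemma base_ge2 : 2 <= b.
Proof. by rewrite ler_nat. Qed.

Lemma base_gt0 : 0 < b.
Proof. exact: lt_le_trans base_ge2. Qed.

Lemma base_neq0 : b != 0.
Proof. by rewrite gt_eqF ?base_gt0. Qed.

Lemma base_pow_gt0 (m : int) : 0 < b ^ m.
Proof. exact: exprz_gt0 base_gt0. Qed.

Lemma unit_roundoff_gt0 : 0 < u.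
Proof. by rewrite divr_gt0 // mulr_gt0 // exprn_gt0 // base_gt0. Qed.

Lemma zero_or_power_ge0 {B : R} : zero_or_power beta B -> 0 <= B.
Proof. by case=> [-> //|[m ->]]; apply/ltW/base_pow_gt0. Qed.

(** Distinct powers of the base differ by at least a factor 2; this is why the
    errors made before a larger power is reached count only half. *)
Lemma zero_or_power_gap {B C : R} :
  zero_or_power beta B -> zero_or_power beta C -> C <= B \/ 2 * B <= C.
Proof.
case=> [-> |[m ->]] hC; first by right; rewrite mulr0 zero_or_power_ge0.
case: hC => [-> |[l ->]]; first by left; apply/ltW/base_pow_gt0.
have b1 : 1 <= b by apply: le_trans base_ge2; rewrite ler1n.
have [lm|ml] := leP l m; first by left; apply: ler_weXz2l.
right; apply: (@le_trans _ _ (b ^ (m + 1))); last by rewrite ler_weXz2l // lezD1.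
rewrite expfzDr ?base_neq0 // expr1z mulrC.
by rewrite ler_pM2l ?base_pow_gt0 // base_ge2.
Qed.

Lemma perfect_system0 : F 0.
Proof. by left. Qed.

Lemma perfect_systemN {v : R} : F v -> F (- v).
Proof.
case=> [-> |[e _ [hv|[w hw <-]]]]; first by left; rewrite oppr0.
- by right; exists e => //; right; exists v.
- by right; exists e => //; left; rewrite opprK.
Qed.

(** The upper end point [q = beta ^ mu.+1] belongs to the next binade; including
    it lets a value be rounded up without leaving the description. *)
Lemma perfect_system_scaled (e : int) (q : nat) :
  (beta ^ mu <= q <= beta ^ mu.+1)%N -> F (b ^ e * q%:R).
Proof.
move=> /andP[le_q q_le]; right.
have [q_lt|q_ge] := ltnP q (beta ^ mu.+1).
  exists e => //; left; exists (q - beta ^ mu)%N; split; last by rewrite subnKC.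
  by rewrite mulnBl mul1n -expnS ltn_sub2r // (leq_ltn_trans le_q).
exists (e + 1) => //; left; exists 0; split.
  by rewrite muln_gt0 subn_gt0 hbeta expn_gt0; case: (beta) hbeta.
have -> : q = (beta ^ mu.+1)%N by apply/eqP; rewrite eqn_leq q_le.
rewrite addn0 expfzDr ?base_neq0 // expr1z -mulrA; congr (_ * _).
by rewrite -natrM expnS.
Qed.

Lemma perfect_system_zero_or_power {B : R} : zero_or_power beta B -> F B.
Proof.
case=> [-> |[m ->]]; first exact: perfect_system0.
have -> : b ^ m = b ^ (m - mu%:Z) * (beta ^ mu)%:R.
  by rewrite natrX exprnP -expfzDr ?base_neq0 // subrK.
by apply: perfect_system_scaled; rewrite leqnn leq_pexp2l //; case: (beta) hbeta.
Qed.

Lemma base_pow_bracket {z : R} :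
  0 < z -> exists m : int, b ^ m <= z < b ^ (m + 1).
Proof.
move=> z0.
pose k := Num.bound z^-1.
have hk : 1 <= z * b ^+ k.
  rewrite mulrC -ler_pdivrMr // mul1r.
  apply/ltW/(lt_le_trans (upper_nthrootP (leqnn _))).
  by rewrite lerXn2r ?nnegrE ?ler0n // base_ge2.
pose w := z * b ^+ k.
have w0 : 0 <= w by apply: le_trans hk.
have /andP[tw wt] := truncn_itv w0.
have t_gt0 : (0 < Num.truncn w)%N by rewrite truncn_gt0.
have /andP[lo hi] := trunc_log_bounds hbeta t_gt0.
set t := trunc_log _ _ in lo hi.
have zE : z = b ^ (- k%:Z) * w.
  by rewrite /w exprnP mulrCA -expfzDr ?base_neq0 // addNr expr0z mulr1.
exists (t%:Z - k%:Z); apply/andP; split.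
  rewrite zE addrC expfzDr ?base_neq0 // ler_pM2l ?base_pow_gt0 //.
  by apply: le_trans tw; rewrite -exprnP -natrX ler_nat.
rewrite zE addrAC addrC expfzDr ?base_neq0 // ltr_pM2l ?base_pow_gt0 //.
apply: (lt_le_trans wt).
have -> : t%:Z + 1 = t.+1%:Z by lia.
by rewrite -exprnP -natrX ler_nat.
Qed.

Lemma exists_nat_within_half {w : R} {l h : nat} :
  l%:R <= w -> w < h%:R ->
  exists2 q : nat, (l <= q <= h)%N & `|q%:R - w| <= 1 / 2.
Proof.
move=> lw wh; have w0 : 0 <= w by apply: le_trans lw.
have /andP[tw wt] := truncn_itv w0.
set t := Num.truncn w in tw wt.
have lt_ : (l <= t)%N by rewrite -ltnS -(ltr_nat R) (le_lt_trans lw).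
have th : (t < h)%N by rewrite -(ltr_nat R) (le_lt_trans tw).
rewrite -natr1 in wt.
have [close|far] := leP (w - t%:R) (1 / 2).
  exists t; first by rewrite lt_ ltnW.
  by rewrite ler_norml; apply/andP; split; lra.
exists t.+1; first by rewrite th (leqW lt_).
by rewrite ler_norml -[t.+1%:R]natr1; apply/andP; split; lra.
Qed.

(** The elements of the system between two consecutive powers [B] and [b * B]
    are the multiples of [2 * u * B]. *)
Lemma perfect_system_dense {z : R} : 0 <= z ->
  exists B q : R, [/\ zero_or_power beta B, B <= z, F q & `|q - z| <= u * B].
Proof.
rewrite le_eqVlt => /predU1P[<-|z0].
  exists 0, 0; split=> //; first by left.
    exact: perfect_system0.
  by rewrite subrr normr0 mulr0.
have [m /andP[mz zm]] := base_pow_bracket z0.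
pose e := m - mu%:Z.
have e0 := base_pow_gt0 e.
pose w := z / b ^ e.
have zE : z = b ^ e * w by rewrite mulrC divfK // gt_eqF.
have mE : b ^ m = b ^ e * (beta ^ mu)%:R.
  by rewrite natrX exprnP -expfzDr ?base_neq0 // subrK.
have m1E : b ^ (m + 1) = b ^ e * (beta ^ mu.+1)%:R.
  rewrite natrX exprnP -expfzDr ?base_neq0 //; congr (_ ^ _); rewrite /e; lia.
have lw : (beta ^ mu)%:R <= w by rewrite -(ler_pM2l e0) -zE -mE.
have wh : w < (beta ^ mu.+1)%:R by rewrite -(ltr_pM2l e0) -zE -m1E.
have [q q_in q_w] := exists_nat_within_half lw wh.
exists (b ^ m), (b ^ e * q%:R); split=> //; first by right; exists m.
  exact: perfect_system_scaled.
rewrite zE -mulrBr normrM (gtr0_norm e0) mE natrX /unit_roundoff.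
have bmu0 : b ^+ mu != 0 by rewrite expf_neq0 ?base_neq0.
have -> : 1 / (2 * b ^+ mu) * (b ^ e * b ^+ mu) = b ^ e * (1 / 2) by field.
by rewrite ler_pM2l.
Qed.

Lemma nearest_error_le_norm {fl : R -> R} (z : R) {q : R} :
  rounds_to_nearest F fl -> F q -> `|fl z - z| <= `|q - `|z| |.
Proof.
move=> hfl Fq; have [_ hz] := hfl z.
have [z0|z0] := ger0P z; first exact: hz.
by apply: (le_trans (hz _ (perfect_systemN Fq))); rewrite -opprD normrN opprK.
Qed.

(** The witness [B] is the unit in the first place of [z].  The second error
    bound is stronger than the first when [z] is just above [B]. *)
Lemma nearest_error_power {fl : R -> R} (z : R) : rounds_to_nearest F fl ->
  exists B : R, [/\ zero_or_power beta B, B <= `|z|,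
                    `|fl z - z| <= u * B & `|fl z - z| <= `|z| - B].
Proof.
move=> hfl; have [B [q [hB Bz Fq qz]]] := perfect_system_dense (normr_ge0 z).
exists B; split=> //.
  exact: le_trans (nearest_error_le_norm z hfl Fq) qz.
apply: le_trans (nearest_error_le_norm z hfl (perfect_system_zero_or_power hB)) _.
by rewrite distrC ger0_norm // subr_ge0.
Qed.

(** * Recursive summation *)

Section RecursiveSum.
Variables (fl : nat -> R -> R) (p : nat -> R).
Hypothesis hfl : forall i, rounds_to_nearest F (fl i).

Fixpoint recsum (k : nat) : R :=
  if k is k'.+1 then fl k' (recsum k' + p k') else 0.

Lemma recsum_in (k : nat) : F (recsum k).
Proof.
by case: k => [|k] /=; [exact: perfect_system0 | case: (hfl k (recsum k + p k))].
Qed.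

(** [E] is the sum of the absolute rounding errors and [B] the largest power met
    so far, with [B = 0] as long as all the sums to be rounded vanish.  If [B]
    was first met at step [K], then [E <= u B (k - K / 2)] and
    [B (1 - K u) <= S - E]; twice the first added to the second gives the last
    inequality, in which [K] no longer occurs. *)
Lemma recsum_invariant (k : nat) :
  let S := \sum_(i < k) `|p i| in
  exists E B : R,
    [/\ zero_or_power beta B, `|recsum k - \sum_(i < k) p i| <= E,
        E <= k%:R * u * B & 2 * E + B <= (S - E) + 2 * (k%:R * u * B)].
Proof.
elim: k => [|k [E [B [hB hE EB SB]]]] /=.
  exists 0, 0; rewrite !big_ord0 subrr normr0; split; [by left| | |]; lra.
rewrite !big_ord_recr /=.
set S := \sum_(i < k) `|p i| in SB *; set P := \sum_(i < k) p i in hE *.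
set s := recsum k in hE *; set z := s + p k.
have u0 := unit_roundoff_gt0.
have B0 := zero_or_power_ge0 hB.
have [C [hC Cz dC dzC]] := nearest_error_power z (hfl k).
have dp : `|fl k z - z| <= `|p k|.
  have [_ hz] := hfl k z.
  by apply: (le_trans (hz _ (recsum_in k))); rewrite opprD addNKr normrN.
set d := `|fl k z - z| in dC dzC dp.
have err' : `|fl k z - (P + p k)| <= E + d.
  have -> : fl k z - (P + p k) = (s - P) + (fl k z - z) by rewrite /z; ring.
  by apply: le_trans (ler_normD _ _) _; rewrite lerD2r.
have zS : `|z| <= S + `|p k| + E.
  have -> : z = (s - P) + (P + p k) by rewrite /z; ring.
  have PS : `|P| <= S by apply: ler_norm_sum.
  by apply: le_trans (ler_normD _ _) _; have := ler_normD P (p k); lra.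
have C0 := zero_or_power_ge0 hC.
rewrite -natr1 !mulrDl !mul1r.
have ku0 : 0 <= k%:R * u by rewrite mulr_ge0 // ltW.
have [CB|BC] := zero_or_power_gap hB hC.
- have uCB : u * C <= u * B by rewrite ler_pM2l.
  by exists (E + d), B; split=> //; lra.
- (* The earlier errors were bounded in terms of [B], at most half of [C]. *)
  have half_error : 2 * (k%:R * u * B) <= k%:R * u * C.
    by rewrite mulrCA ler_wpM2l.
  have kuB0 : 0 <= k%:R * u * B by rewrite mulr_ge0.
  by exists (E + d), C; split=> //; lra.
Qed.

Lemma recsum_error (N : nat) : 2 * (N%:R * u) <= 1 ->
  `|recsum N - \sum_(i < N) p i|
    <= (N%:R * u) / (1 + N%:R * u) * \sum_(i < N) `|p i|.
Proof.
move=> small; have [E [B [hB hE EB SB]]] := recsum_invariant N.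
apply: (le_trans hE).
set S := \sum_(i < N) `|p i| in SB *.
have a0 : 0 <= N%:R * u by rewrite mulr_ge0 // ltW // unit_roundoff_gt0.
set a := N%:R * u in small a0 EB SB *.
rewrite mulrAC ler_pdivlMr; last by lra.
have B0 := zero_or_power_ge0 hB.
(* Both factors of [(1 - 2 a) (a B - E)] are nonnegative. *)
have h1 : 0 <= (1 - 2 * a) * (a * B - E) by rewrite mulr_ge0 //; lra.
have h2 : a * (2 * E + B) <= a * ((S - E) + 2 * (a * B)) by rewrite ler_wpM2l.
by nra.
Qed.

End RecursiveSum.
End PerfectSystem.

(** * The dot product *)

(** The first operation [fl (x_0 * y_0)] rounds [0 + x_0 * y_0], so that the dot
    product is a recursive summation from 0 with one rounding per product. *)
Lemma fma_partial_recsum (R : realType) (n : nat) (fl : 'I_n.+1 -> R -> R)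
    (x y : 'rV[R]_n.+1) (k : nat) :
  fma_partial fl x y k =
  recsum R (fun i => fl (inord i))
    (fun i => x ord0 (inord i) * y ord0 (inord i)) k.+1.
Proof. by elim: k => [|k IHk]; [rewrite /= add0r | rewrite [LHS]/= IHk]. Qed.

Lemma unit_roundoff_le_quarter (R : realType) {beta mu : nat} :
  (2 <= beta)%N -> (1 <= mu)%N -> 4 * unit_roundoff R beta mu <= 1.
Proof.
move=> hbeta hmu; have hpow : (2 <= beta ^ mu)%N.
  by apply: (leq_trans hbeta); rewrite -{1}(expn1 beta) leq_pexp2l // ltnW.
have : 2 <= (beta%:R ^+ mu : R) by rewrite -natrX ler_nat.
set c := _ ^+ _ => c2; rewrite /unit_roundoff -/c mulrA mulr1.
by rewrite ler_pdivrMr; lra.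
Qed.

Theorem corollary8 (R : realType) (beta mu n : nat)
    (hbeta : (2 <= beta)%N) (hmu : (1 <= mu)%N)
    (fl : 'I_n.+1 -> R -> R)
    (hfl : forall i : 'I_n.+1, rounds_to_nearest (perfect_system R beta mu) (fl i))
    (hn : 20 * n%:R * unit_roundoff R beta mu <= 1)
    (x y : 'rV[R]_n.+1) :
  `| fma_dot fl x y - \sum_(k < n.+1) x ord0 k * y ord0 k |
    <= (n.+1%:R * unit_roundoff R beta mu)
         / (1 + n.+1%:R * unit_roundoff R beta mu)
       * \sum_(k < n.+1) `| x ord0 k * y ord0 k |.
Proof.
have small : 2 * (n.+1%:R * unit_roundoff R beta mu) <= 1.
  have u4 := unit_roundoff_le_quarter R hbeta hmu.
  by rewrite -natr1 mulrDl mul1r; lra.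
pose p i := x ord0 (inord i) * y ord0 (inord i).
have := recsum_error R beta mu hbeta (fun i => fl (inord i)) p
  (fun i => hfl (inord i)) n.+1 small.
rewrite -fma_partial_recsum.
under eq_bigr do rewrite /p inord_val.
by under [in X in _ <= X]eq_bigr do rewrite /p inord_val.
Qed.
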